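(* Let $N\ge2$ be an integer, $q,\sigma,\Delta,v>0$ and $0\le s\le\sqrt{2N/(N-1)}$. Let $$c^{*}=\sqrt{q\sigma^2\Delta}\,\sqrt{N+\tfrac{s^2}{2}(N-1)\bigl(N(1+v(N-1))-2\bigr)+s(N-1)\sqrt{(1+Nv)(2N-(N-1)s^2)}},$$ and let $c^{\mathrm{SQ}}$, $c^{\mathrm{BP}}$, $c^{\mathrm{SYM}}$ be the aggregate trading costs $$c^{\mathrm{SQ}}=\sum_{i=1}^N\sqrt{\sigma_{0i}^2E[Q_i]\Delta},\qquad c^{\mathrm{BP}}=\sum_{0\le i<j\le N}\sqrt{\sigma_{ij}^2E[Q_{ij}]\Delta},\qquad c^{\mathrm{SYM}}=\sqrt{\frac{2\Delta H\,E[Q]}{N+1}}$$ evaluated at $E[Q_{0i}]=q$, $\sigma_{0i}^2=\sigma^2$ for $i\ge1$, and $E[Q_{ij}]=vq$, $\sigma_{ij}^2=s^2\sigma^2$ for $i\ne j$, $i,j\ge1$, where $E[Q_i]=\sum_{j\ne i}E[Q_{ij}]$, $E[Q]=\sum_{i<j}E[Q_{ij}]$, $H=\sum_{i<j}\sigma_{ij}^2$. Then: (1) $c^*\le c^{\mathrm{SQ}}$ whenever $s<\sqrt{\frac{2(1+Nv)}{1+(N-1)v}}$. As a function of $v$, this threshold equals $\sqrt2$ at $v=0$ and increases to $\sqrt{\frac{2N}{N-1}}$ as $v\to\infty$. (2) $c^{\mathrm{BP}}<c^{\mathrm{SQ}}$ whenever $s<\frac{2(\sqrt{1+(N-1)v}-1)}{(N-1)\sqrt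 v}$. This threshold tends to $0$ as $v\to0^+$ and approaches $\frac{2}{\sqrt{N-1}}$ as $v\to\infty$. (3) $c^*\le c^{\mathrm{SYM}}$; and $c^{\mathrm{SYM}}<c^{\mathrm{SQ}}$ whenever $s<\sqrt{\frac{2(1+Nv)}{2+(N-1)v}}$. This last threshold equals $1$ at $v=0$ and approaches $\sqrt{\frac{2N}{N-1}}$ as $v\to\infty$.
   Context: Currency $0$ is the vehicle currency and $1,\dots,N$ are symmetric currencies. $E[Q_{ij}]=E[Q_{ji}]$ is the expected volume on pair $(i,j)$, $\sigma_{ij}^2$ the variance of the difference of the returns of $i$ and $j$, and $\Delta$ the trade size. $c^{\mathrm{SQ}}$ is the aggregate cost of routing every trade through currency $0$ by bilateral pools, $c^{\mathrm{BP}}$ that of a dedicated bilateral pool for each pair, $c^{\mathrm{SYM}}$ that of a single equal-weighted pool. $c^*$ is the closed-form cost of the weight-optimized constant-mean pool; for $0<s<\sqrt{2(1+Nv)/(1+(N-1)v)}$ it is the minimum over weights $w_i>0$, $\sum_i w_i=1$, of $\sqrt{\Delta\,(\sum_{i<j}w_iw_j\sigma_{ij}^2)\sum_iE[Q_i]/w_i}$, attained at an interior point. *)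

(* Defs.v *)
From mathcomp Require Import all_boot all_order all_algebra.
From mathcomp Require Import all_classical all_reals all_analysis.

Set Implicit Arguments.
Unset Strict Implicit.
Unset Printing Implicit Defensive.

Import Order.TTheory GRing.Theory Num.Theory.
Import numFieldNormedType.Exports.

Local Open Scope classical_set_scope.
Local Open Scope ring_scope.

(* The currencies are the elements of 'I_N.+1, the vehicle currency being ord0.
   EQ i j stands for the expected volume E[Q_ij] of the pair (i, j), and var i j
   for the variance sigma_ij^2 (already squared).  Both are symmetric arrays in
   the intended use, and their diagonal entries are never read. *)
Section Costs.
Variables (R : realType) (N : nat).
Implicit Types (EQ var : 'I_N.+1 -> 'I_N.+1 -> R) (Delta : R).

Definition currency_volume EQ (i : 'I_N.+1) : R :=
  \sum_(j < N.+1 | j != i) EQ i j.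

Definition total_volume EQ : R :=
  \sum_(i < N.+1) \sum_(j < N.+1 | (i < j)%N) EQ i j.

Definition total_variance var : R :=
  \sum_(i < N.+1) \sum_(j < N.+1 | (i < j)%N) var i j.

Definition cost_SQ EQ var Delta : R :=
  \sum_(i < N.+1 | i != ord0)
    Num.sqrt (var ord0 i * currency_volume EQ i * Delta).

Definition cost_BP EQ var Delta : R :=
  \sum_(i < N.+1) \sum_(j < N.+1 | (i < j)%N)
    Num.sqrt (var i j * EQ i j * Delta).

Definition cost_SYM EQ var Delta : R :=
  Num.sqrt (2 * Delta * total_variance var * total_volume EQ / (N%:R + 1)).

End Costs.

Section ClosedForms.
Variables (R : realType) (N : nat).
Implicit Types (q sigma Delta v s : R).

(* The closed form of the minimum, over positive weights w_i summing to 1, of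
   sqrt (Delta * (\sum_(i<j) w_i w_j sigma_ij^2) * \sum_i E[Q_i] / w_i), which is
   attained for 0 < s < threshold_star N v; beyond that range it is taken as a
   definition.  Both radicands are nonnegative for s^2 <= 2N/(N-1). *)
Definition cost_star q sigma Delta v s : R :=
  Num.sqrt (q * sigma ^+ 2 * Delta) *
  Num.sqrt (N%:R
    + s ^+ 2 / 2 * (N%:R - 1) * (N%:R * (1 + v * (N%:R - 1)) - 2)
    + s * (N%:R - 1) *
      Num.sqrt ((1 + N%:R * v) * (2 * N%:R - (N%:R - 1) * s ^+ 2))).

Definition threshold_star v : R :=
  Num.sqrt (2 * (1 + N%:R * v) / (1 + (N%:R - 1) * v)).

Definition threshold_BP v : R :=
  2 * (Num.sqrt (1 + (N%:R - 1) * v) - 1) / ((N%:R - 1) * Num.sqrt v).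

Definition threshold_SYM v : R :=
  Num.sqrt (2 * (1 + N%:R * v) / (2 + (N%:R - 1) * v)).

End ClosedForms.

Arguments cost_star {R} N q sigma Delta v s.
Arguments threshold_star {R} N v.
Arguments threshold_BP {R} N v.
Arguments threshold_SYM {R} N v.

(* Main.v *)
(* With A = 1 + N v and B = 2N - (N-1) s^2, the cost of the constant-mean pool
   whose vehicle weight is 1/u has square q sigma^2 Delta times
     (N-1)/2 (s^2 u + A B / u) + a term independent of u,
   and c* is obtained by replacing s^2 u + A B / u by its lower bound
   2 s sqrt(A B).  So AM-GM gives c* <= (cost at u) for every u > 0.  The choice
   u = N + 1 is the equal-weighted pool, and u = 1, where all the weight sits on
   the vehicle, gives exactly c^SQ; hence c* <= c^SQ holds for all admissible s. *)

Require Import Defs.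
From mathcomp Require Import all_boot all_order all_algebra.
From mathcomp Require Import all_classical all_reals all_analysis.
From mathcomp Require Import ring lra.

Set Implicit Arguments.
Unset Strict Implicit.
Unset Printing Implicit Defensive.

Import Order.TTheory GRing.Theory Num.Theory.
Import numFieldNormedType.Exports.

Local Open Scope classical_set_scope.
Local Open Scope ring_scope.

(** * Sums over pairs of currencies *)

Lemma sum_ord_pairs_const (R : realType) (N : nat) (b : R) :
  \sum_(i < N) \sum_(j < N | (i < j)%N) b = N%:R * (N%:R - 1) / 2 * b.
Proof.
(* With the larger index [j] outside, the inner range is the initial segment of length [j], which
   leaves an arithmetic series. *)
rewrite (exchange_big_dep predT) //=.
have -> : \sum_(j < N) \sum_(i < N | (i < j)%N) b = \sum_(j < N) b *+ j.
  apply: eq_bigr => j _.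
  rewrite -(big_ord_widen N (fun=> b)) ?(ltnW (ltn_ord j)) //.
  by rewrite sumr_const card_ord.
elim: N => [|N IHN]; first by rewrite big_ord0 !mul0r.
by rewrite big_ord_recr /= IHN -mulr_natl -natr1; field.
Qed.

(** As [ord0] is the least index, the pairs [i < j] split into [N] pairs with the vehicle and
    [N (N - 1) / 2] pairs of symmetric currencies. This evaluates the total volume, the total
    variance and the bilateral cost alike. *)
Lemma sum_pairs_vehicle (R : realType) (N : nat)
    (F : 'I_N.+1 -> 'I_N.+1 -> R) (a b : R) :
  (forall j, j != ord0 -> F ord0 j = a) ->
  (forall i j, i != ord0 -> j != ord0 -> i != j -> F i j = b) ->
  \sum_(i < N.+1) \sum_(j < N.+1 | (i < j)%N) F i j
  = N%:R * a + N%:R * (N%:R - 1) / 2 * b.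
Proof.
move=> Fa Fb; rewrite big_ord_recl; congr (_ + _).
  rewrite big_mkcond big_ord_recl /= add0r.
  under eq_bigr => j _ do rewrite Fa //.
  by rewrite sumr_const card_ord mulr_natl.
rewrite -sum_ord_pairs_const; apply: eq_bigr => i _.
rewrite big_mkcond big_ord_recl /= add0r [RHS]big_mkcond /=.
apply: eq_bigr => j _; rewrite /bump /= !add1n ltnS.
case: ifP => // ij; rewrite Fb //.
by apply: contraTneq ij => /lift_inj ->; rewrite ltnn.
Qed.

Lemma currency_volume_vehicle (R : realType) (N : nat)
    (EQ : 'I_N.+1 -> 'I_N.+1 -> R) (a b : R) (i : 'I_N.+1) :
  i != ord0 -> EQ i ord0 = a ->
  (forall j, j != ord0 -> i != j -> EQ i j = b) ->
  currency_volume EQ i = a + (N%:R - 1) * b.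
Proof.
move=> i0 EQa EQb; rewrite /currency_volume.
rewrite (bigD1 ord0) 1?eq_sym //= EQa; congr (_ + _).
rewrite (eq_bigr (fun=> b)); last first.
  by move=> j /andP[ji j0]; rewrite EQb // eq_sym.
rewrite sumr_const -[LHS]mulr_natl; congr (_ * _).
(* The remaining indices are counted as the complement of the two distinct elements [i] and [ord0]
   among [N + 1]; the count is kept as a successor equal to [N], which avoids truncated
   subtraction. *)
have /eqP := cardC (pred2 i ord0).
rewrite card2 i0 card_ord => /eqP cardE.
rewrite (eq_card (B := [predC pred2 i ord0])); last first.
  by move=> j; rewrite !inE negb_or.
have cN : #|[predC pred2 i ord0]|.+1 = N by case: cardE.
by rewrite -[in RHS]cN -natr1 addrK.
Qed.

(** * The arithmetic-geometric mean bound on the closed form *)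

Lemma mulr_sqrt_le (R : realType) (s y u : R) : 0 <= y -> 0 < u ->
  s * Num.sqrt y <= (s ^+ 2 * u + y / u) / 2.
Proof.
move=> y0 u0; rewrite -subr_ge0 -{1}(sqr_sqrtr y0).
suff -> : (s ^+ 2 * u + Num.sqrt y ^+ 2 / u) / 2 - s * Num.sqrt y
          = (s * u - Num.sqrt y) ^+ 2 / (2 * u).
  by rewrite divr_ge0 ?sqr_ge0 ?mulr_ge0 // ltW.
by field; rewrite gt_eqF.
Qed.

(* The right-hand side is the cost of the constant-mean pool with weights
   [w_0 = 1 / u] and [w_i = (u - 1) / (N u)]; at [u = 1] it is degenerate. *)
Lemma cost_star_le (R : realType) (N : nat) (q sigma Delta v s u : R) :
  (2 <= N)%N -> 0 <= q -> 0 <= Delta -> 0 <= v ->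
  0 <= s -> s <= Num.sqrt (2 * N%:R / (N%:R - 1)) -> 0 < u ->
  cost_star N q sigma Delta v s <=
  Num.sqrt (q * sigma ^+ 2 * Delta) *
  Num.sqrt ((u + (N%:R - 1) * (1 + N%:R * v)) *
            ((N%:R - 1) * s ^+ 2 * u + (2 * N%:R - (N%:R - 1) * s ^+ 2))
            / (2 * u)).
Proof.
move=> hN q0 D0 v0 s0 hs u0.
have n2 : 2 <= N%:R :> R by rewrite ler_nat.
have m0 : 0 < N%:R - 1 :> R by lra.
(* The upper bound on [s], once squared, is exactly the nonnegativity of this factor of the inner
   radicand. *)
have B0 : 0 <= 2 * N%:R - (N%:R - 1) * s ^+ 2.
  have t0 : 0 <= 2 * N%:R / (N%:R - 1) :> R by rewrite divr_ge0 ?ltW //; lra.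
  rewrite subr_ge0 mulrC -ler_pdivlMr //.
  by rewrite -[leRHS](sqr_sqrtr t0) lerXn2r // nnegrE sqrtr_ge0.
have A0 : 0 <= 1 + N%:R * v by rewrite addr_ge0 // mulr_ge0.
apply: ler_wpM2l; first exact: sqrtr_ge0.
apply: ler_wsqrtr.
have := @mulr_sqrt_le R s _ u (mulr_ge0 A0 B0) u0.
move=> /(ler_wpM2l (ltW m0)) amgm.
(* Subtracting the terms of [cost_star] free of the inner root leaves on the right
   [(N - 1) / 2 * (s^2 u + y / u)], with [y] the inner radicand; this is the bound [amgm]. *)
rewrite -lerBrDl (mulrC s) -[leLHS]mulrA.
apply: (le_trans amgm); rewrite le_eqVlt; apply: predU1l.
by field; rewrite gt_eqF.
Qed.

(** * Values of the three costs, with the factor [sqrt (q sigma^2 Delta)] of [cost_star] pulled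
    out *)

Section CostValues.
Context {R : realType} {N : nat} {q sigma Delta v s : R}.
Context {EQ var : 'I_N.+1 -> 'I_N.+1 -> R}.
Hypotheses (hq : 0 < q) (hDelta : 0 < Delta).
Hypothesis hs0 : 0 <= s.
Hypothesis EQ_sym : forall i j, EQ i j = EQ j i.
Hypothesis EQ_vehicle : forall i, i != ord0 -> EQ ord0 i = q.
Hypothesis var_vehicle : forall i, i != ord0 -> var ord0 i = sigma ^+ 2.
Hypothesis EQ_other :
  forall i j, i != ord0 -> j != ord0 -> i != j -> EQ i j = v * q.
Hypothesis var_other :
  forall i j, i != ord0 -> j != ord0 -> i != j ->
    var i j = s ^+ 2 * sigma ^+ 2.

Let k0 : 0 <= q * sigma ^+ 2 * Delta.
Proof. by apply: mulr_ge0 (ltW hDelta); apply: mulr_ge0 (ltW hq) (sqr_ge0 _). Qed.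

Lemma cost_SQE : cost_SQ EQ var Delta =
  Num.sqrt (q * sigma ^+ 2 * Delta)
  * (N%:R * Num.sqrt (1 + (N%:R - 1) * v)).
Proof.
rewrite /cost_SQ (eq_bigr (fun=> Num.sqrt (q * sigma ^+ 2 * Delta)
  * Num.sqrt (1 + (N%:R - 1) * v))); last first.
  move=> i i0; rewrite (currency_volume_vehicle (a := q) (b := v * q)) //.
  - by rewrite var_vehicle // -sqrtrM //; congr Num.sqrt; ring.
  - by rewrite EQ_sym EQ_vehicle.
  - by move=> j j0 ij; rewrite EQ_other.
rewrite sumr_const -[LHS]mulr_natl.
rewrite (eq_card (B := predC1 ord0)) // cardC1 card_ord /=; ring.
Qed.

Lemma cost_BPE : cost_BP EQ var Delta =
  Num.sqrt (q * sigma ^+ 2 * Delta)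
  * (N%:R * (1 + (N%:R - 1) * (s * Num.sqrt v) / 2)).
Proof.
rewrite /cost_BP (sum_pairs_vehicle (a := Num.sqrt (q * sigma ^+ 2 * Delta))
  (b := Num.sqrt (q * sigma ^+ 2 * Delta) * (s * Num.sqrt v))).
- by field.
- by move=> j j0; rewrite var_vehicle // EQ_vehicle //; congr Num.sqrt; ring.
- move=> i j i0 j0 ij; rewrite var_other // EQ_other //.
  (* Since [s] is nonnegative, it equals [sqrt (s^2)] and can go under the root. *)
  rewrite -{2}(ger0_norm hs0) -sqrtr_sqr -sqrtrM ?sqr_ge0 // -sqrtrM //.
  by congr Num.sqrt; ring.
Qed.

Lemma cost_SYME : cost_SYM EQ var Delta =
  Num.sqrt (q * sigma ^+ 2 * Delta)
  * (N%:R * Num.sqrt ((2 + (N%:R - 1) * s ^+ 2) * (2 + (N%:R - 1) * v)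
                      / (2 * (N%:R + 1)))).
Proof.
have n0 : 0 <= N%:R :> R by [].
rewrite -{1}(ger0_norm n0) -sqrtr_sqr -sqrtrM ?sqr_ge0 // -sqrtrM //.
rewrite /cost_SYM /total_variance /total_volume.
(* The two totals are [N sigma^2 (2 + (N - 1) s^2) / 2] and [N q (2 + (N - 1) v) / 2]; their product
   supplies the [N^2] that comes out of the root. *)
rewrite (sum_pairs_vehicle var_vehicle var_other).
rewrite (sum_pairs_vehicle EQ_vehicle EQ_other).
congr Num.sqrt; field.
by apply/negP => /eqP; lra.
Qed.

End CostValues.

(** * Limits and monotonicity of the thresholds *)

Lemma cvg_div_affine_pinfty (R : realType) (a b c d : R) : 0 < d ->
  (a + b * x) / (c + d * x) @[x --> +oo%R] --> b / d.
Proof.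
move=> d0.
have affine_gt A : \forall x \near +oo%R, A < c + d * x.
  near=> x; rewrite -ltrBlDl mulrC -ltr_pdivrMr //.
  by near: x; apply: nbhs_pinfty_gt; exact: num_real.
have inv0 : (c + d * x)^-1 @[x --> +oo%R] --> (0 : R).
  by apply/gtr0_cvgV0; [exact: affine_gt|apply/cvgryPgt].
(* Division with remainder: the quotient is the constant [b / d] and the remainder term vanishes at
   infinity. *)
have lim : b / d + (a - b * c / d) * (c + d * x)^-1 @[x --> +oo%R] --> b / d.
  rewrite -[X in _ --> X]addr0 -(mulr0 (a - b * c / d)).
  by apply: cvgD; [exact: cvg_cst|apply: cvgM => //; exact: cvg_cst].
apply: cvg_trans lim; apply: near_eq_cvg; near=> x.
field; rewrite (gt_eqF d0) /= gt_eqF //.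
by near: x; exact: affine_gt.
Unshelve. all: by end_near. Qed.

Lemma cvg_sqrt_div_affine_pinfty (R : realType) (a b c d : R) : 0 < d ->
  Num.sqrt (2 * (a + b * x) / (c + d * x)) @[x --> +oo%R]
    --> Num.sqrt (2 * b / d).
Proof.
move=> d0.
under eq_fun => x do rewrite mulrDr mulrA.
apply: (continuous_cvg _ (@sqrt_continuous R _)).
exact: cvg_div_affine_pinfty.
Qed.

(** The radicand is twice a homographic function of determinant [N - (N - 1) = 1], so
    cross-multiplication leaves [2 (y - x)]. *)
Lemma threshold_star_mono (R : realType) (N : nat) (x y : R) : (1 <= N)%N ->
  0 <= x -> x < y -> threshold_star N x < threshold_star N y.
Proof.
move=> hN x0 xy.
have n1 : 1 <= N%:R :> R by rewrite ler1n.
have d (z : R) : 0 <= z -> 0 < 1 + (N%:R - 1) * z.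
  by move=> z0; rewrite ltr_wpDr // mulr_ge0 //; lra.
have y0 : 0 <= y by lra.
have p : 0 < 1 + N%:R * y by rewrite ltr_wpDr // mulr_ge0.
rewrite /threshold_star ltr_sqrt; last by rewrite divr_gt0 ?mulr_gt0 ?d.
rewrite ltr_pdivrMr ?d // mulrAC ltr_pdivlMr ?d //.
rewrite -subr_gt0; have -> : 2 * (1 + N%:R * y) * (1 + (N%:R - 1) * x)
  - 2 * (1 + N%:R * x) * (1 + (N%:R - 1) * y) = 2 * (y - x) by ring.
by lra.
Qed.

(** The quotient has the form 0/0 at the origin. Multiplying by the conjugate [D x] of the numerator
    turns it into [2 sqrt x / D x], which is continuous there. *)
Lemma threshold_BP_at0 (R : realType) (N : nat) : (2 <= N)%N ->
  threshold_BP N x @[x --> (0 : R)^'+] --> (0 : R).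
Proof.
move=> hN.
have n2 : 2 <= N%:R :> R by rewrite ler_nat.
pose D (x : R) := Num.sqrt (1 + (N%:R - 1) * x) + 1.
have D0 x : 0 < D x by rewrite ltr_wpDl // sqrtr_ge0.
have lim : 2 * Num.sqrt x / D x @[x --> (0 : R)^'+] --> (0 : R).
  rewrite -[X in _ --> X](_ : 2 * Num.sqrt 0 / D 0 = 0); last first.
    by rewrite sqrtr0 mulr0 mul0r.
  apply: cvg_at_right_filter; apply: cvgM.
    by apply: cvgM; [exact: cvg_cst|exact: sqrt_continuous].
  apply: cvgV; first by rewrite gt_eqF.
  apply: cvgD; last exact: cvg_cst.
  apply: (continuous_cvg _ (@sqrt_continuous R _)).
  by apply: cvgD; [exact: cvg_cst|apply: cvgM; [exact: cvg_cst|exact: cvg_id]].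
apply: cvg_trans lim; apply: near_eq_cvg; near=> x.
have x0 : 0 < x by near: x; exact: nbhs_right_gt.
have r0 : Num.sqrt x != 0 by rewrite gt_eqF // sqrtr_gt0.
have m0 : N%:R - 1 != 0 :> R by rewrite gt_eqF //; lra.
have Dx := D0 x; rewrite /threshold_BP /D in Dx *.
apply/eqP; rewrite eqr_div ?mulf_neq0 ?(gt_eqF Dx) //; apply/eqP.
have e1 : 0 <= 1 + (N%:R - 1) * x by rewrite addr_ge0 // mulr_ge0 ?ltW //; lra.
have := sqr_sqrtr e1; have := sqr_sqrtr (ltW x0).
set r := Num.sqrt x; set t := Num.sqrt _ => rE tE.
transitivity (2 * (N%:R - 1) * r ^+ 2); first by ring.
rewrite rE; transitivity (2 * (t ^+ 2 - 1)); last by ring.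
by rewrite tE; ring.
Unshelve. all: by end_near. Qed.

Lemma threshold_BP_pinfty (R : realType) (N : nat) : (2 <= N)%N ->
  threshold_BP N x @[x --> +oo%R] --> (2 / Num.sqrt (N%:R - 1) : R).
Proof.
move=> hN.
have n2 : 2 <= N%:R :> R by rewrite ler_nat.
have m0 : 0 < N%:R - 1 :> R by lra.
(* Dividing numerator and denominator by [sqrt x] makes the threshold a multiple of
   [g 1 (N - 1) x - g 1 0 x]; the denominator [0 + 1 * x] is shaped to fit
   [cvg_div_affine_pinfty]. *)
pose g a b (x : R) := Num.sqrt ((a + b * x) / (0 + 1 * x)).
have glim a b : g a b x @[x --> +oo%R] --> Num.sqrt b.
  apply: (continuous_cvg _ (@sqrt_continuous R _)).
  by rewrite -{2}[b]divr1; exact: cvg_div_affine_pinfty.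
have lim : 2 / (N%:R - 1) * (g 1 (N%:R - 1) x - g 1 0 x) @[x --> +oo%R]
    --> (2 / Num.sqrt (N%:R - 1) : R).
  have -> : 2 / Num.sqrt (N%:R - 1)
      = 2 / (N%:R - 1) * (Num.sqrt (N%:R - 1) - Num.sqrt 0) :> R.
    rewrite sqrtr0 subr0 -{2}(sqr_sqrtr (ltW m0)).
    by field; rewrite gt_eqF // sqrtr_gt0.
  apply: cvgM; first exact: cvg_cst.
  by apply: cvgB; exact: glim.
apply: cvg_trans lim; apply: near_eq_cvg; near=> x.
have x0 : 0 < x by near: x; apply: nbhs_pinfty_gt; exact: num_real.
have r0 : Num.sqrt x != 0 by rewrite gt_eqF // sqrtr_gt0.
have e1 : 0 <= 1 + (N%:R - 1) * x by rewrite addr_ge0 // mulr_ge0 ?ltW //; lra.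
rewrite /threshold_BP /g add0r mul1r mul0r addr0.
rewrite !sqrtrM // sqrtr1 sqrtrV ?ltW //.
by field; rewrite r0 gt_eqF.
Unshelve. all: by end_near. Qed.

(** * Comparison of the costs *)

Theorem proposition11 (R : realType) (N : nat) (q sigma Delta v s : R)
    (EQ var : 'I_N.+1 -> 'I_N.+1 -> R)
    (hN : (2 <= N)%N)
    (hq : 0 < q) (hsigma : 0 < sigma) (hDelta : 0 < Delta) (hv : 0 < v)
    (hs0 : 0 <= s) (hs : s <= Num.sqrt (2 * N%:R / (N%:R - 1)))
    (EQ_sym : forall i j : 'I_N.+1, EQ i j = EQ j i)
    (var_sym : forall i j : 'I_N.+1, var i j = var j i)
    (EQ_vehicle : forall i : 'I_N.+1, i != ord0 -> EQ ord0 i = q)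
    (var_vehicle : forall i : 'I_N.+1, i != ord0 -> var ord0 i = sigma ^+ 2)
    (EQ_other : forall i j : 'I_N.+1,
        i != ord0 -> j != ord0 -> i != j -> EQ i j = v * q)
    (var_other : forall i j : 'I_N.+1,
        i != ord0 -> j != ord0 -> i != j -> var i j = s ^+ 2 * sigma ^+ 2) :
  [/\ [/\ s < threshold_star N v ->
            cost_star N q sigma Delta v s <= cost_SQ EQ var Delta,
          threshold_star N (0 : R) = Num.sqrt 2,
          (forall x y : R, 0 <= x -> x < y ->
             threshold_star N x < threshold_star N y) &
          threshold_star N x @[x --> +oo%R]
            --> Num.sqrt (2 * N%:R / (N%:R - 1) : R)],
      [/\ s < threshold_BP N v ->
            cost_BP EQ var Delta < cost_SQ EQ var Delta,
          threshold_BP N x @[x --> (0 : R)^'+] --> (0 : R) &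
          threshold_BP N x @[x --> +oo%R]
            --> (2 / Num.sqrt (N%:R - 1) : R)] &
      [/\ cost_star N q sigma Delta v s <= cost_SYM EQ var Delta,
          (s < threshold_SYM N v ->
            cost_SYM EQ var Delta < cost_SQ EQ var Delta),
          threshold_SYM N (0 : R) = 1 &
          threshold_SYM N x @[x --> +oo%R]
            --> Num.sqrt (2 * N%:R / (N%:R - 1) : R)]].
Proof.
have n2 : 2 <= N%:R :> R by rewrite ler_nat.
have m0 : 0 < N%:R - 1 :> R by lra.
have k0 : 0 < Num.sqrt (q * sigma ^+ 2 * Delta).
  by rewrite sqrtr_gt0 !mulr_gt0 // exprn_gt0.
have mv0 : 0 < (N%:R - 1) * v by rewrite mulr_gt0.
have nv0 : 0 < N%:R * v by rewrite mulr_gt0 //; lra.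
have SQ : cost_SQ EQ var Delta = _ :=
  cost_SQE hq hDelta EQ_sym EQ_vehicle var_vehicle EQ_other.
have BP : cost_BP EQ var Delta = _ :=
  cost_BPE hq hDelta hs0 EQ_vehicle var_vehicle EQ_other var_other.
have SYM : cost_SYM EQ var Delta = _ :=
  cost_SYME hq hDelta EQ_vehicle var_vehicle EQ_other var_other.
have nsqrt (y : R) : N%:R * Num.sqrt y = Num.sqrt (N%:R ^+ 2 * y).
  by rewrite sqrtrM ?sqr_ge0 // sqrtr_sqr ger0_norm.
split; split.
- move=> _; rewrite SQ nsqrt.
  (* At [u = 1] the [s^2] terms cancel: the two factors become [N (1 + (N - 1) v)] and [2 N]. *)
  apply: (le_trans (@cost_star_le _ _ _ _ _ _ _ 1 _ _ _ _ _ _ _)) => //.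
  1-3: exact: ltW.
  rewrite le_eqVlt; apply: predU1l.
  by congr (_ * Num.sqrt _); field.
- by rewrite /threshold_star !mulr0 !addr0 divr1 mulr1.
- by move=> x y; apply: threshold_star_mono; exact: ltnW.
- exact: cvg_sqrt_div_affine_pinfty.
- rewrite /threshold_BP ltr_pdivlMr ?mulr_gt0 ?sqrtr_gt0 // => sv.
  rewrite BP SQ ltr_pM2l // ltr_pM2l; last by lra.
  by lra.
- exact: threshold_BP_at0.
- exact: threshold_BP_pinfty.
- rewrite SYM nsqrt.
  (* At [u = N + 1] the factors become [N (2 + (N - 1) v)] and [N (2 + (N - 1) s^2)]. *)
  apply: (le_trans (@cost_star_le _ _ _ _ _ _ _ (N%:R + 1) _ _ _ _ _ _ _)) => //.
  1-3: exact: ltW.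
  rewrite le_eqVlt; apply: predU1l.
  by congr (_ * Num.sqrt _); field; rewrite gt_eqF //; lra.
- have t0 : 0 <= 2 * (1 + N%:R * v) / (2 + (N%:R - 1) * v).
    by rewrite divr_ge0 //; lra.
  rewrite /threshold_SYM => st.
  have : s ^+ 2 < 2 * (1 + N%:R * v) / (2 + (N%:R - 1) * v).
    by rewrite -[ltRHS](sqr_sqrtr t0) ltrXn2r // nnegrE sqrtr_ge0.
  rewrite ltr_pdivlMr; last by lra.
  (* Adding [2 (2 + (N - 1) v)] to both sides of [hlt] gives [(2 + (N - 1) s^2) (2 + (N - 1) v) < 2
     (N + 1) (1 + (N - 1) v)], the comparison of the squared costs. *)
  rewrite -(ltr_pM2l m0) => hlt.
  rewrite SYM SQ ltr_pM2l // ltr_pM2l ?ltr_sqrt; [|lra|lra].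
  by rewrite ltr_pdivrMr; lra.
- by rewrite /threshold_SYM !mulr0 !addr0 mulr1 divff ?sqrtr1.
- exact: cvg_sqrt_div_affine_pinfty.
Qed.
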